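(* Let $(\mathfrak g,\omega,J)$ be a real Lie algebra with abelian pseudo-Kähler structure whose pseudo-Kähler metric is Einstein but not Ricci flat. Then $(\mathfrak g,\omega,J)$ is holomorphically symplectomorphic to $\mathfrak{aff}(\mathcal A)$ endowed with the standard abelian pseudo-Kähler structure, where $(\mathcal A,B)$ is a real symmetric associative commutative algebra such that $\mathcal A$ is semisimple and the symmetric form $B$ on $\mathcal A$ is, up to a scalar, the trace form of the regular representation, i.e. $B(a,b)=\gamma\,\mathrm{trace}(R_{ab})$ for some $\gamma\in\mathbb R$, where $R_c$ denotes multiplication by $c$ in $\mathcal A$.
   Context: All algebras are finite dimensional. An abelian complex structure on a real Lie algebra $\mathfrak g$ is a linear map $J$ with $J^2=-\mathrm{id}$ and $[Jx,Jy]=[x,y]$. A symplectic form is a non-degenerate skew-symmetric bilinear form $\omega$ with $\omega([x,y],z)+\omega([y,z],x)+\omega([z,x],y)=0$. An abelian pseudo-Kähler structure is a pair $(\omega,J)$ with $J$ an abelian complex structure, $\omega$ symplectic, and $\omega(Jx,Jy)=\omega(x,y)$. The pseudo-Kähler metric is $g(x,y)=\omega(Jx,y)$. Its Levi-Civita connection $\nabla$ on $\mathfrak g$ is given by $2g(\nabla_xy,z)=g([x,y],z)-g([y,z],x)+g([z,x],y)$, its curvature by $\mathbf R(x,y)=\nabla_{[x,y]}-\nabla_x\nabla_y+\nabla_y\nabla_x$, and $\mathrm{Ric}(x,y)=\mathrm{trace}(z\mapsto\mathbf R(x,z)y)$. The metric is Einstein if there is $\gamma\in\mathbb R$ with $g=\gamma\,\mathrm{Ric}$,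 and Ricci flat if $\mathrm{Ric}=0$. A real symmetric associative commutative algebra is a real associative commutative algebra $\mathcal A$ with a non-degenerate symmetric bilinear form $B$ such that $B(ab,c)=B(a,bc)$. $\mathfrak{aff}(\mathcal A)=\mathcal A\oplus\mathcal A$ has bracket $[(a,b),(a',b')]=(0,ab'-a'b)$; its standard pseudo-Kähler structure is $J(a,b)=(-b,a)$, $\omega((a,b),(a',b'))=B(a,b')-B(b,a')$. Two pseudo-Kähler Lie algebras are holomorphically symplectomorphic if there is a Lie algebra isomorphism between them intertwining the complex structures and the symplectic forms. *)

(* Defs.v *)
From HB Require Import structures.
From mathcomp Require Import all_boot all_order all_algebra.
From mathcomp Require Import boolp classical_sets reals.

Set Implicit Arguments.
Unset Strict Implicit.
Unset Printing Implicit Defensive.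

Import GRing.Theory Num.Theory.
Local Open Scope ring_scope.

Section Trace.
Variables (R : realType) (V : vectType R).

(* [linfun] turns a bare function into an element of 'End(V); the result is
   the given function only when that function is linear, which is the case in
   both uses below (the Ricci tensor and the trace form of an algebra). *)
Definition trace (f : V -> V) : R :=
  \tr (passmx.mxof (vbasis {:V}) (vbasis {:V}) (linfun f)).

End Trace.

Section LieAlgebra.
Variables (R : realType) (V : vectType R).

Record lie_bracket (br : {bilinear V -> V -> V}) : Prop := LieBracket {
  lie_alternating : forall x, br x x = 0;
  lie_jacobi : forall x y z,
    br x (br y z) + br y (br z x) + br z (br x y) = 0
}.

Record abelian_complex_structure (br : V -> V -> V) (J : 'End(V)) : Prop :=
  AbelianComplexStructure {
    complex_sqr : forall x, J (J x) = - x;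
    complex_abelian : forall x y, br (J x) (J y) = br x y
  }.

Record symplectic_form (br : V -> V -> V) (omega : {skew_symmetric V}) : Prop :=
  SymplecticForm {
    symplectic_nondegenerate : nondegenerate omega;
    symplectic_closed : forall x y z,
      omega (br x y) z + omega (br y z) x + omega (br z x) y = 0
  }.

Record abelian_pseudo_kahler (br : V -> V -> V) (omega : {skew_symmetric V})
    (J : 'End(V)) : Prop := AbelianPseudoKahler {
  pseudo_kahler_complex : abelian_complex_structure br J;
  pseudo_kahler_symplectic : symplectic_form br omega;
  pseudo_kahler_compatible : forall x y, omega (J x) (J y) = omega x y
}.

Definition kahler_metric (omega : V -> V -> R) (J : V -> V) (x y : V) : R :=
  omega (J x) y.

(* When [g] is non-degenerate there is exactly one such vector; see
   [levi_civitaP]. *)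
Definition levi_civita (br : V -> V -> V) (g : V -> V -> R) (x y : V) : V :=
  xget 0 [set v | forall z,
    2%:R * g v z = g (br x y) z - g (br y z) x + g (br z x) y].

Definition curvature (br : V -> V -> V) (g : V -> V -> R) (x y z : V) : V :=
  let nabla := levi_civita br g in
  nabla (br x y) z - nabla x (nabla y z) + nabla y (nabla x z).

Definition ricci (br : V -> V -> V) (g : V -> V -> R) (x y : V) : R :=
  trace (fun z => curvature br g x z y).

Definition einstein (br : V -> V -> V) (g : V -> V -> R) : Prop :=
  exists gamma : R, forall x y, g x y = gamma * ricci br g x y.

Definition ricci_flat (br : V -> V -> V) (g : V -> V -> R) : Prop :=
  forall x y, ricci br g x y = 0.

Lemma levi_civitaP (br : {bilinear V -> V -> V}) (omega : {skew_symmetric V})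
    (J : 'End(V)) (g := kahler_metric omega J) :
  abelian_pseudo_kahler br omega J ->
  forall x y z, 2%:R * g (levi_civita br g x y) z =
    g (br x y) z - g (br y z) x + g (br z x) y.
Proof.
move=> [[JJ _] [/eqP nd _] _] x y.
have gl a u v z : g (a *: u + v) z = a * g u z + g v z.
  by rewrite /g /kahler_metric linearP linearPl.
have gr u : linear (g u : V -> R^o).
  by move=> a v w; rewrite /g /kahler_metric linearPr.
pose gL u := HB.pack_for {linear V -> R^o} (g u : V -> R^o)
  (GRing.isLinear.Build _ _ _ _ _ (gr u)).
pose phi u := linfun (gL u).
have phiE u z : phi u z = g u z by rewrite lfunE.
have phi_lin : linear phi.
  by move=> a u v; apply/lfunP => z; rewrite add_lfunE scale_lfunE !phiE gl.
pose phiL := HB.pack_for {linear V -> 'Hom(V, R^o)} phi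
  (GRing.isLinear.Build _ _ _ _ _ phi_lin).
have ker0 : lker (linfun phiL) == 0%VS.
  apply/lker0P => u v; rewrite !lfunE /= => /lfunP phiuv.
  have : J (u - v) \in orthov omega {:V}.
    apply/mem_orthovP => z _.
    have := phiuv z; rewrite !phiE /g /kahler_metric => uvz.
    rewrite (linearB J) linearBl; apply/eqP; rewrite subr_eq0; apply/eqP.
    exact: uvz.
  rewrite nd memv0 => /eqP Juv0.
  by have /eqP := JJ (u - v); rewrite Juv0 linear0 eq_sym oppr_eq0 subr_eq0 => /eqP.
have img : limg (linfun phiL) = fullv.
  apply/eqP; rewrite eqEdim subvf limg_dim_eq ?(eqP ker0) ?capv0 //.
  by rewrite !dimvf /dim /= muln1.
pose rhs z : R^o := 2%:R^-1 * (g (br x y) z - g (br y z) x + g (br z x) y).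
have rhs_lin : linear rhs.
  move=> a u v; rewrite /rhs gr linearPr linearPl !gl /=.
  rewrite -[a *: _]/(a * _) -[a *: _]/(a * _) mulrCA -mulrDr; congr (_ * _).
  rewrite !mulrDr mulrN opprD -!addrA; congr (_ + _).
  rewrite addrCA; congr (_ + _); rewrite [RHS]addrCA; congr (_ + _).
  by rewrite addrCA.
pose rhsL := HB.pack_for {linear V -> R^o} rhs
  (GRing.isLinear.Build _ _ _ _ _ rhs_lin).
have /memv_imgP[v _ vE] : linfun rhsL \in limg (linfun phiL).
  by rewrite img memvf.
apply: (@xgetPex _ 0 [set v | forall z, 2%:R * g v z =
  g (br x y) z - g (br y z) x + g (br z x) y]).
exists v => z; move/lfunP: vE => /(_ z); rewrite !lfunE /= => <-.
by rewrite /rhs mulVKf // pnatr_eq0.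
Qed.

End LieAlgebra.

Section CommutativeAlgebra.
Variables (R : realType) (A : vectType R).

(* The algebra is not assumed to have a unit. *)
Record symmetric_algebra (mul : {bilinear A -> A -> A}) (B : {symmetric A})
    : Prop := SymmetricAlgebra {
  algebra_associative : associative mul;
  algebra_commutative : commutative mul;
  form_nondegenerate : nondegenerate B;
  form_invariant : forall a b c, B (mul a b) c = B a (mul b c)
}.

Definition ideal (mul : A -> A -> A) (I : {vspace A}) : Prop :=
  forall a x, x \in I -> mul a x \in I /\ mul x a \in I.

(* I ^ (n + 1) = 0 for some n. *)
Definition nilpotent (mul : A -> A -> A) (I : {vspace A}) : Prop :=
  exists n, forall (x : A) (s : seq A),
    x \in I -> {in s, forall y, y \in I} -> size s = n -> foldl mul x s = 0.

(* The radical of a finite dimensional algebra is its largest nilpotent ideal;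
   this notion does not refer to a unit. *)
Definition radical (mul : A -> A -> A) (N : {vspace A}) : Prop :=
  [/\ ideal mul N, nilpotent mul N &
      forall I : {vspace A}, ideal mul I -> nilpotent mul I -> (I <= N)%VS].

Definition semisimple (mul : A -> A -> A) : Prop := radical mul 0%VS.

Definition trace_form (mul : A -> A -> A) (a b : A) : R :=
  trace (mul (mul a b)).

Definition aff_bracket (mul : A -> A -> A) (u v : (A * A)%type) : (A * A)%type :=
  (0, mul u.1 v.2 - mul v.1 u.2).

Definition aff_complex (u : (A * A)%type) : (A * A)%type := (- u.2, u.1).

Definition aff_symplectic (B : A -> A -> R) (u v : (A * A)%type) : R :=
  B u.1 v.2 - B u.2 v.1.

End CommutativeAlgebra.

Definition holomorphically_symplectomorphic (R : realType) (V W : vectType R)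
    (brV : V -> V -> V) (omegaV : V -> V -> R) (JV : V -> V)
    (brW : W -> W -> W) (omegaW : W -> W -> R) (JW : W -> W) : Prop :=
  exists f : 'Hom(V, W),
    [/\ bijective f,
        forall x y, f (brV x y) = brW (f x) (f y),
        forall x, f (JV x) = JW (f x) &
        forall x y, omegaW (f x) (f y) = omegaV x y].

(* Main.v *)
Require Import Defs.
From mathcomp Require Import all_boot all_order all_algebra.
From mathcomp Require Import reals.
From HB Require Import structures.
From mathcomp Require Import boolp lra ring.

(* With [ad x = br x] and [tau = trace \o ad], the first Bianchi identity and
   [nabla J = 0] express [Ric(x, y) + Ric(Jy, Jx)] as the trace of
   [J R(Jy, x)], which equals [2 tau (J [x, Jy])].  The Einstein equation at
   [(x, y)] and at [(Jy, Jx)] thus gives [omega(x, y) = - gamma tau (J [x, y])].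
   The derived algebra [D] is abelian, so it is isotropic for this form.  If [z]
   and [J z] lie in [D], then [ad (J [z, x]) = - ad x \o ad (J z)] is traceless,
   so [z = 0].  If [x] is orthogonal to [D + J D], then [ad x] and [ad (J x)] are
   infinitesimally [omega]-skew, whence [[J x, y] = J [x, y]] lies in
   [D] and [J D], so [x = 0].  Therefore [V = D + J D] is a direct sum and [D]
   with the product [[a, J b]] is the required algebra; its invariant form
   [omega(a, J b)] is a multiple of the trace form, and being nondegenerate it
   leaves no room for a nilpotent ideal. *)

Set Implicit Arguments.
Unset Strict Implicit.
Unset Printing Implicit Defensive.

Import GRing.Theory Num.Theory.
Import passmx.
Local Open Scope ring_scope.

(** * Linear algebra: traces of endomorphisms and nondegenerate forms *)

Lemma linfun_linear (R : nzRingType) (U V : vectType R) (f : U -> V) :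
  linear f -> linfun f =1 f.
Proof.
move=> fP x; pose F := HB.pack_for {linear U -> V} f
  (GRing.isLinear.Build _ _ _ _ _ fP).
exact: (lfunE F).
Qed.

(* Through a rank factorization [M = C D], the trace of [M] is that of [D C],
   whose nilpotency index is smaller by one. *)
Lemma mxtrace_nilpotent (F : fieldType) (n k : nat) (M : 'M[F]_n) :
  iter k (mulmx M) 1%:M = 0 -> \tr M = 0.
Proof.
elim: k n M => [|k IHk] n M Mk.
  by rewrite -[M]mulmx1 [1%:M]Mk mulmx0 mxtrace0.
have [C_full D_free MCD] :=
  And3 (col_base_full M) (row_base_free M) (esym (mulmx_base M)).
move: C_full D_free MCD; move: (\rank M) (col_base M) (row_base M).
move=> r C D C_full D_free MCD; rewrite {}MCD mxtrace_mulC in Mk *.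
apply: IHk; apply: (row_full_inj C_full); apply: (row_free_inj D_free) => /=.
rewrite mulmx0 mul0mx -{}Mk.
elim: k => [|k IHk]; first by rewrite /= !mulmx1.
by rewrite [RHS]iterS -IHk iterS !mulmxA.
Qed.

Section TraceTheory.
Variable R : realType.

Lemma traceD (V : vectType R) (f g : 'End(V)) :
  trace (f + g) = trace f + trace g.
Proof. by rewrite /trace !fun_of_lfunK !raddfD. Qed.

Lemma traceN (V : vectType R) (f : 'End(V)) : trace (- f) = - trace f.
Proof. by rewrite /trace !fun_of_lfunK !raddfN. Qed.

Lemma traceB (V : vectType R) (f g : 'End(V)) :
  trace (f - g) = trace f - trace g.
Proof. by rewrite traceD traceN. Qed.

Lemma eq_trace (V : vectType R) (f g : V -> V) : f =1 g -> trace f = trace g.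
Proof. by move=> /funext ->. Qed.

Lemma trace_eq0 (V : vectType R) (f : V -> V) : (forall x, f x = 0) -> trace f = 0.
Proof.
move=> f0; rewrite (@eq_trace _ f (0 : 'End(V))) => [|x]; last first.
  by rewrite f0 zero_lfunE.
by rewrite /trace fun_of_lfunK !raddf0.
Qed.

Lemma trace_comp (V W : vectType R) (f : 'Hom(V, W)) (g : 'Hom(W, V)) :
  trace (g \o f)%VF = trace (f \o g)%VF.
Proof.
rewrite /trace !fun_of_lfunK.
rewrite (mxof_comp _ _ (vbasisP {:W})) (mxof_comp _ _ (vbasisP {:V})).
exact: mxtrace_mulC.
Qed.

Lemma trace_nilpotent (V : vectType R) (k : nat) (f : 'End(V)) :
  (forall x, iter k f x = 0) -> trace f = 0.
Proof.
move=> fk0; rewrite /trace fun_of_lfunK.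
set e := vbasis _; have e_basis : basis_of {:V} e := vbasisP _.
apply: (@mxtrace_nilpotent _ _ k); apply/row_matrixP => i; rewrite row0.
have iterM : forall j, iter j (mulmx (mxof e e f)) 1%:M =
    mxof e e (iter j (comp_lfun f) \1%VF).
  elim=> [|j IHj]; first by rewrite mxof1 // (basis_free e_basis).
  rewrite !iterS IHj -mxof_comp //; congr (mxof e e _).
  elim: j {IHj} => [|j IHj]; first by rewrite /= comp_lfun1l comp_lfun1r.
  by rewrite iterS -comp_lfunA IHj.
rewrite iterM rowE mul_mxof; apply/eqP; rewrite rVof_eq0 //.
have -> : forall x, iter k (comp_lfun f) \1%VF x = iter k f x.
  by elim: k {fk0 iterM} => [|k IHk] x; rewrite /= ?id_lfunE // comp_lfunE IHk.
by rewrite fk0.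
Qed.

Variables (V : vectType R) (omega : {skew_symmetric V}).
Hypothesis omega_nd : nondegenerate omega.

Lemma nondegenerate_eq (u v : V) : (forall w, omega u w = omega v w) -> u = v.
Proof.
move=> uv; apply/eqP; rewrite -subr_eq0 -memv0 -(eqP omega_nd).
by apply/mem_orthovP => w _; rewrite linearBl /= uv subrr.
Qed.

(** With the Gram matrix [G] of [omega], adjointness reads [F G = G H^T] for the matrices [F] of [f]
    and [H] of [h], so [F] is conjugate to [H^T]. *)
Lemma trace_adjoint (f h : 'End(V)) :
  (forall x y, omega (f x) y = omega x (h y)) -> trace f = trace h.
Proof.
move=> adj; rewrite /trace !fun_of_lfunK.
set e := vbasis _; have e_basis : basis_of {:V} e := vbasisP _.
pose G : 'M[R]_(\dim {:V}) := \matrix_(i, j) omega e`_i e`_j.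
have omegaE u v : omega (vecof e u) (vecof e v) = (u *m G *m v^T) 0 0.
  rewrite linear_sumlz mxE; under [RHS]eq_bigr do rewrite mxE big_distrl.
  rewrite /= [RHS]exchange_big; apply: eq_bigr => i _.
  rewrite linear_sumr; apply: eq_bigr => j _.
  by rewrite linearZlr /= !mxE; ring.
have G_unit : G \in unitmx.
  rewrite -row_free_unit; apply: inj_row_free => u uG0.
  apply/eqP; rewrite -(vecof_eq0 e_basis); apply/eqP; apply: nondegenerate_eq => w.
  by rewrite linear0l -[w](rVofK e_basis) omegaE uG0 mul0mx mxE.
have FG : mxof e e f *m G = G *m (mxof e e h)^T.
  apply/matrixP => i j.
  have := adj e`_i e`_j; rewrite -!vecof_delta !(hom_vecof e e_basis) !omegaE.
  by rewrite trmx_mul -rowE !mulmxA trmx_delta -!rowE -!row_mul -!colE !mxE.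
rewrite -[mxof e e f](mulmxK G_unit) FG mxtrace_mulC mulmxA mulVmx // mul1mx.
by rewrite mxtrace_tr.
Qed.

(** Pairing with a basis of [U] is injective on the whole space, which bounds its dimension by that
    of [U]. *)
Lemma nondegenerate_fullv (U : {vspace V}) :
  (forall x, (forall u, u \in U -> omega u x = 0) -> x = 0) -> U = fullv.
Proof.
move=> Uperp; pose phi x : 'rV[R]_(\dim U) := \row_i omega (vbasis U)`_i x.
have phi_lin : linear phi.
  by move=> a x y; apply/rowP => i; rewrite !mxE linearPr.
have ker0 : lker (linfun phi) == 0%VS.
  apply/eqP/vspaceP => x; rewrite memv_ker memv0 linfun_linear //.
  apply/eqP/eqP => [/rowP phix0|->]; last first.
    by apply/rowP => i; rewrite !mxE linear0r.
  apply: Uperp => u /coord_vbasis ->; rewrite linear_sumlz big1 // => i _.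
  by have := phix0 i; rewrite !mxE linearZl_LR /= => ->; rewrite mulr0.
apply/eqP; rewrite eqEdim subvf -(limg_dim_eq (f := linfun phi)).
  by rewrite (leq_trans (dimvS (subvf _))) // dimvf /dim /= mul1n.
by rewrite (eqP ker0) capv0.
Qed.

End TraceTheory.

(** * Lie algebras with an abelian complex structure are metabelian *)

Section AbelianComplexStructure.
Variables (R : realType) (V : vectType R).
Variables (br : {bilinear V -> V -> V}) (J : 'End(V)).
Hypotheses (br_lie : lie_bracket br) (J_abelian : abelian_complex_structure br J).

Let brNl x y : br (- x) y = - br x y. Proof. exact: (linearNl br). Qed.
Let brNr x y : br x (- y) = - br x y. Proof. exact: (linearNr br). Qed.

Lemma lieC x y : br x y = - br y x.
Proof.
have := lie_alternating br_lie (x + y).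
rewrite linearDl !linearDr !(lie_alternating br_lie) add0r addr0.
by move/eqP; rewrite addr_eq0 => /eqP.
Qed.

Lemma lie_leibniz x y z : br (br x y) z = br (br x z) y + br x (br y z).
Proof.
have := lie_jacobi br_lie x y z.
rewrite (lieC z (br x y)) (lieC y (br z x)) (lieC z x) brNl opprK.
by move/eqP; rewrite subr_eq0 addrC => /eqP <-.
Qed.

Lemma brJl x y : br (J x) y = - br x (J y).
Proof.
rewrite -(complex_abelian J_abelian x) (complex_sqr J_abelian).
by rewrite brNr opprK.
Qed.

(* Over the complex numbers, for [a = x - i J x] of type (1,0) and
   [b = y + i J y] of type (0,1), the (0,1)-part of [br a b] is [t + i J t] with
   [t = dot x y] and its (1,0)-part is [s - i J s] with [s = - dot y x].  As both
   types are abelian subalgebras, [br (br x y) (br u v) = 0] is Ito's theorem. *)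
Let dot x y := br x y - J (br x (J y)).

Let J_dot x y : J (dot x y) = dot x (J y).
Proof.
by rewrite /dot linearB /= !(complex_sqr J_abelian) brNr !linearN /= !opprK addrC.
Qed.

(** The Leibniz rule expands both terms of [E]. The parts containing [br x z] and [br (J x) (J z)]
    cancel since [J] is abelian, and the rest is the right-hand side. *)
Let br_dot_swap x y z : br (dot x y) z = br (dot z y) x.
Proof.
have E u v w : br (dot u v) w = br (br u v) w - br (br (J u) v) (J w).
  by rewrite linearBl /= brJl (brJl u) brNl.
rewrite !E (lie_leibniz x y z) (lie_leibniz (J x) y (J z)).
rewrite (complex_abelian J_abelian) opprD addrACA subrr add0r.
by rewrite (lieC x) (lieC (J x)) (lieC y) (lieC y (J z)) !brNl !opprK.
Qed.

Let dot_swapl x y z : dot (dot x y) z = dot (dot z y) x.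
Proof.
rewrite {1 3}/dot br_dot_swap; congr (_ - J _).
by apply: oppr_inj; rewrite -!brJl !J_dot br_dot_swap.
Qed.

Let dot_swapr x y z : dot z (dot x y) = dot x (dot z y).
Proof.
rewrite {1 3}/dot !J_dot.
by rewrite !(lieC _ (dot _ _)) br_dot_swap (br_dot_swap x (J y)).
Qed.

Let dot_flip x y u v : dot (dot x y) (dot u v) = dot (dot v u) (dot y x).
Proof.
rewrite dot_swapr (dot_swapl x) -dot_swapr dot_swapl (dot_swapl u).
by rewrite dot_swapl.
Qed.

Let br_dot x y : br x y *+ 2 = dot x y - dot y x.
Proof.
rewrite /dot (lieC y) (lieC y (J x)) brJl opprK opprD !opprK.
by rewrite addrACA addNr addr0 mulr2n.
Qed.

Lemma abelian_complex_metabelian x y u v : br (br x y) (br u v) = 0.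
Proof.
have double_inj (a b : V) : a *+ 2 = b *+ 2 -> a = b.
  rewrite -!scaler_nat; by apply: scalerI; rewrite pnatr_eq0.
(* [dot_flip] reverses both inner products and also exchanges them; the exchange costs a sign in the
   difference given by [br_dot]. *)
have flip a b c d : br (dot a b) (dot c d) = - br (dot b a) (dot d c).
  apply: double_inj; rewrite mulNrn !br_dot opprB.
  by rewrite (dot_flip a) (dot_flip c).
have brMn2 a b : br (a *+ 2) (b *+ 2) = br a b *+ 2 *+ 2.
  by rewrite linearMnr linearMnl.
(* [br_dot] needs each inner bracket doubled, so the claim is multiplied by four; [flip] then
   cancels the four terms in pairs. *)
apply: (double_inj _ 0); apply: (double_inj _ (0 *+ 2)).
rewrite -brMn2 !br_dot !mul0rn.
rewrite linearBl /= !(linearBr br _ (dot u v)) /= (flip x y) (flip x y).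
by rewrite opprK [X in X - _]addrC subrr.
Qed.

End AbelianComplexStructure.

(** * Connection, curvature and Ricci tensor of an abelian pseudo-Kähler metric *)

Section PseudoKahler.
Variables (R : realType) (V : vectType R).
Variables (br : {bilinear V -> V -> V}) (omega : {skew_symmetric V}) (J : 'End(V)).
Hypotheses (br_lie : lie_bracket br) (pK : abelian_pseudo_kahler br omega J).

Let J_abelian := pseudo_kahler_complex pK.
Let JJ := complex_sqr J_abelian.
Let brJJ := complex_abelian J_abelian.
Let omega_nd := symplectic_nondegenerate (pseudo_kahler_symplectic pK).
Let omega_closed := symplectic_closed (pseudo_kahler_symplectic pK).
Let omegaD u v w : omega (u + v) w = omega u w + omega v w.
Proof. exact: (linearDl omega). Qed.
Let omegaN u w : omega (- u) w = - omega u w.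
Proof. exact: (linearNl omega). Qed.
Let omegaZ a u w : omega (a *: u) w = a * omega u w.
Proof. exact: (linearZl_LR omega). Qed.
Let omegaE := (omegaD, omegaN, omegaZ).

Lemma skew_symmetricC u v : omega u v = - omega v u.
Proof. by rewrite hermC expr1 mulN1r. Qed.

Lemma omega_Jl u v : omega (J u) v = - omega u (J v).
Proof. by rewrite -(pseudo_kahler_compatible pK u) JJ linearNr opprK. Qed.

Let brJ x y : br (J x) y = - br x (J y) := brJl J_abelian x y.

Definition ad x : 'End(V) := linfun (br x).

Lemma adE x y : ad x y = br x y. Proof. exact: lfunE. Qed.

Local Notation g := (kahler_metric omega J).
Local Notation nabla := (levi_civita br g).
Local Notation curv := (curvature br g).

(** Closedness at [(y, z, J x)], [(z, x, J y)] and [(x, y, J z)] moves [J] inside the brackets of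
    the Koszul formula. The terms paired with [x] cancel and the others occur twice, absorbing the
    factor 2. *)
Lemma levi_civitaE x y z :
  omega (J (nabla x y)) z = omega (br x (J y)) z + omega (br (J x) z) y.
Proof.
have := levi_civitaP pK x y z; rewrite /kahler_metric.
rewrite !(omega_Jl (br _ _)).
have := omega_closed y z (J x); have := omega_closed z x (J y).
have := omega_closed x y (J z).
rewrite (brJ z) (brJ y) (brJ x y) (lieC br_lie z (J x)) opprK.
rewrite !omegaE; lra.
Qed.

Lemma levi_civita_eq x y v :
  (forall z, omega (J v) z = omega (br x (J y)) z + omega (br (J x) z) y) ->
  nabla x y = v.
Proof.
move=> vE; apply: oppr_inj; rewrite -!JJ; congr (J _).
by apply: (nondegenerate_eq omega_nd) => z; rewrite levi_civitaE vE.
Qed.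

Lemma levi_civita_linear x : linear (nabla x).
Proof.
move=> a u v; apply: levi_civita_eq => z.
rewrite !linearP /= !omegaE !levi_civitaE /=; lra.
Qed.

Lemma levi_civita_linearl y : linear (nabla^~ y).
Proof.
move=> a u v; apply: levi_civita_eq => z.
rewrite !linearP /= !(linearPl br) !omegaE !levi_civitaE /=; lra.
Qed.

Lemma levi_civita_torsion x y : nabla x y - nabla y x = br x y.
Proof.
apply/eqP; rewrite subr_eq; apply/eqP/levi_civita_eq => z.
rewrite linearD omegaE levi_civitaE omega_Jl.
have := omega_closed x y (J z).
rewrite (brJ z) (brJ y) (lieC br_lie z (J x)) (lieC br_lie y (J x)) (brJ x y) !opprK.
rewrite !omegaE; lra.
Qed.

(** The closedness relations at [(x, y, z)] and [(x, J y, J z)] share the term [omega (br y z) x];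
    their difference is the claim paired with [z]. *)
Lemma levi_civita_J x y : nabla x (J y) = J (nabla x y).
Proof.
apply: levi_civita_eq => z; rewrite (omega_Jl (J _)) levi_civitaE JJ.
rewrite linearNr brJJ; have := omega_closed x y z.
have := omega_closed x (J y) (J z).
rewrite brJJ (brJ z) (lieC br_lie z (J x)) opprK (lieC br_lie z x) !omegaE; lra.
Qed.

Let nablaEnd x : 'End(V) := linfun (nabla x).
Let nablaEndE x y : nablaEnd x y = nabla x y.
Proof. by rewrite linfun_linear //; apply: levi_civita_linear. Qed.

Lemma levi_civitaD x : {morph nabla x : u v / u + v}.
Proof. by move=> u v; rewrite -!nablaEndE linearD. Qed.

Lemma levi_civitaN x : {morph nabla x : u / - u}.
Proof. by move=> u; rewrite -!nablaEndE linearN. Qed.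

Lemma levi_civitaNl y : {morph nabla^~ y : u / - u}.
Proof.
by move=> u; rewrite -!(linfun_linear (levi_civita_linearl y)) linearN.
Qed.

(** By [levi_civitaE], the [omega]-adjoint of [J \o nabla x - ad x \o J] is [- ad (J x)], and
    [ad x \o J] is itself [- ad (J x)]. *)
Lemma trace_J_levi_civita x :
  trace (J \o linfun (nabla x))%VF = - (trace (ad (J x)) *+ 2).
Proof.
rewrite -/(nablaEnd x).
have adJ : (ad x \o J = - ad (J x))%VF.
  by apply/lfunP => y; rewrite opp_lfunE comp_lfunE !adE brJ opprK.
have : trace ((J \o nablaEnd x)%VF - (ad x \o J)%VF) = trace (- ad (J x)).
  apply: (trace_adjoint omega_nd) => y z.
  rewrite (skew_symmetricC y) add_lfunE !opp_lfunE !comp_lfunE nablaEndE !adE.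
  rewrite omegaE omegaN.
  rewrite levi_civitaE omegaN; lra.
by rewrite traceB adJ !traceN opprK => /(canRL (addrK _)) ->; rewrite mulr2n opprD.
Qed.

Lemma curvature_linear x y : linear (fun z => curv x z y).
Proof.
move=> a u v; rewrite /curvature (linearPr br) !levi_civita_linearl.
rewrite levi_civita_linear scalerDr scalerBr.
by apply: (nondegenerate_eq omega_nd) => w; rewrite !omegaE; lra.
Qed.

Lemma curvature_linearr x y : linear (curv x y).
Proof.
by move=> a u v; rewrite /curvature -!nablaEndE !linearP /=;
  apply: (nondegenerate_eq omega_nd) => w; rewrite !omegaE; lra.
Qed.

Lemma curvature_J x y z : curv x y (J z) = J (curv x y z).
Proof. by rewrite /curvature !levi_civita_J linearD linearB /=. Qed.

Lemma curvatureC x y z : curv x y z = - curv y x z.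
Proof.
rewrite /curvature (lieC br_lie x) levi_civitaNl.
by apply: (nondegenerate_eq omega_nd) => w; rewrite !omegaE; lra.
Qed.

Lemma first_bianchi x y z : curv x y z + curv y z x + curv z x y = 0.
Proof.
(* Vanishing torsion, used twice, makes the second derivatives cancel in the cyclic sum and leaves a
   Jacobi sum. *)
have swap u v w : nabla (br u v) w =
    nabla w (nabla u v) - nabla w (nabla v u) - br w (br u v).
  rewrite -levi_civitaN -levi_civitaD levi_civita_torsion.
  by rewrite -(levi_civita_torsion w) opprB addrC subrK.
rewrite /curvature !swap; apply: (nondegenerate_eq omega_nd) => w.
have := congr1 (omega^~ w) (lie_jacobi br_lie x y z).
by rewrite linear0l !omegaE; lra.
Qed.

(** This is [J] applied to the Bianchi identity at [(J y, x, z)], as [J] commutes with curvature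
    endomorphisms. *)
Lemma curvature_ricci_pair x y z :
  curv x z y + curv (J y) z (J x) = J (curv (J y) x z).
Proof.
have -> : curv (J y) x z = - curv x z (J y) - curv z (J y) x.
  by apply/eqP; rewrite -opprD eq_sym eqr_oppLR -addr_eq0 first_bianchi.
rewrite linearB (linearN J) /= (curvature_J x) JJ -(curvature_J z) (curvatureC z).
by rewrite !opprK.
Qed.

(** Since [J] is parallel, the two products of connection maps form a commutator, which is
    traceless; only [J \o nabla (br (J y) x)] contributes. *)
Lemma trace_J_curvature x y :
  trace (J \o linfun (curv (J y) x))%VF = trace (ad (J (br x (J y)))) *+ 2.
Proof.
have -> : (J \o linfun (curv (J y) x))%VF = (J \o nablaEnd (br (J y) x))%VF
    - ((J \o nablaEnd (J y)) \o nablaEnd x)%VF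
    + (nablaEnd x \o (J \o nablaEnd (J y)))%VF.
  apply/lfunP => z; rewrite !(add_lfunE, opp_lfunE, comp_lfunE) !nablaEndE.
  rewrite linfun_linear; last exact: curvature_linearr.
  by rewrite (levi_civita_J x) /curvature linearD linearB.
rewrite traceD traceB -(trace_comp (nablaEnd x)) subrK trace_J_levi_civita.
rewrite (lieC br_lie x) -mulNrn -traceN; congr (_ *+ 2); apply: eq_trace => z.
by rewrite opp_lfunE !adE linearN (linearNl br).
Qed.

(* The pair [(J y, J x)] is added to [(x, y)] so that the first Bianchi identity
   applies pointwise, without the pair symmetry of the curvature. *)
Lemma ricci_pair x y :
  ricci br g x y + ricci br g (J y) (J x) = trace (ad (J (br x (J y)))) *+ 2.
Proof.
rewrite -trace_J_curvature /ricci.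
have E u v : trace (fun z => curv u z v) = trace (linfun (fun z => curv u z v)).
  by apply: eq_trace => z; rewrite linfun_linear //; apply: curvature_linear.
rewrite !E -traceD; congr trace; apply/funext => z.
rewrite add_lfunE comp_lfunE !linfun_linear ?curvature_ricci_pair //.
- exact: curvature_linearr.
- exact: curvature_linear.
- exact: curvature_linear.
Qed.

Lemma einstein_omega (gamma : R) :
  (forall x y, g x y = gamma * ricci br g x y) ->
  forall x y, omega x y = - gamma * trace (ad (J (br x y))).
Proof.
move=> einst x y.
(* With [J x] in place of [x], both metric values equal [- omega x y]. *)
have := congr1 ( *%R gamma) (ricci_pair (J x) y).
rewrite mulrDr -!einst /kahler_metric !JJ brJJ !omegaN (linearNr omega) opprK.
by rewrite /= (skew_symmetricC y); lra.
Qed.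

End PseudoKahler.

(** * Trace forms and nilpotent ideals *)

Section TraceFormAlgebra.
Variables (R : realType) (A : vectType R).
Variables (mul : {bilinear A -> A -> A}) (B : {symmetric A}).

Lemma trace_mul_nilpotent_ideal (I : {vspace A}) (x : A) :
  commutative mul -> ideal mul I -> nilpotent mul I -> x \in I ->
  trace (mul x) = 0.
Proof.
move=> mulC idI [n nilI] xI; have mulE : linfun (mul x) =1 mul x := lfunE _.
(* One multiplication by [x] brings [z] into [I]; the other [n] then produce a product of [n.+1]
   elements of [I]. *)
rewrite -(eq_trace mulE); apply: (@trace_nilpotent _ _ n.+1) => z.
have foldE k w : foldl mul w (nseq k x) = iter k (linfun (mul x)) w.
  by elim: k w => [|k IHk] w //=; rewrite IHk -iterS iterSr mulE mulC.
rewrite iterSr -foldE mulE nilI ?size_nseq //; first by case: (idI z x xI).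
by move=> y /nseqP[-> _].
Qed.

Lemma trace_form_semisimple (gamma : R) :
  symmetric_algebra mul B -> (forall a b, B a b = gamma * trace_form mul a b) ->
  semisimple mul.
Proof.
move=> [_ mulC nd _] BE; split.
- by move=> a x; rewrite memv0 => /eqP ->; rewrite linear0l linear0r memv0.
- by exists 0%N => x s; rewrite memv0 => /eqP -> _ /size0nil ->.
- move=> I idI nilI; apply/subvP => x xI; rewrite -(eqP nd).
  apply/mem_orthovP => a _; rewrite BE /trace_form.
  rewrite (trace_mul_nilpotent_ideal mulC idI nilI) ?mulr0 //.
  by case: (idI a x xI).
Qed.

End TraceFormAlgebra.

(** * Structure of the Lie algebra when [omega] comes from the trace of [ad] *)

Section TraceSymplectic.
Variables (R : realType) (V : vectType R).
Variables (br : {bilinear V -> V -> V}) (omega : {skew_symmetric V}) (J : 'End(V)).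
Hypotheses (br_lie : lie_bracket br) (pK : abelian_pseudo_kahler br omega J).
Variable c : R.
Hypothesis omega_trace : forall x y, omega x y = c * trace (ad br (J (br x y))).

Let J_abelian := pseudo_kahler_complex pK.
Let JJ := complex_sqr J_abelian.
Let brJJ := complex_abelian J_abelian.
Let omega_nd := symplectic_nondegenerate (pseudo_kahler_symplectic pK).
Let omega_closed := symplectic_closed (pseudo_kahler_symplectic pK).
Let brJ x y : br (J x) y = - br x (J y) := brJl J_abelian x y.
Let skewC u v : omega u v = - omega v u := skew_symmetricC omega u v.
Let omega_J u v : omega (J u) v = - omega u (J v) := omega_Jl pK u v.

Definition derived : {vspace V} :=
  (\sum_(i < \dim {:V}) limg (ad br (vbasis {:V})`_i))%VS.

Lemma memv_derived x y : br x y \in derived.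
Proof.
rewrite [x](coord_vbasis (memvf x)) linear_sumlz; apply: memv_sumr => i _.
by rewrite linearZl_LR /= -adE -linearZ memv_img ?memvf.
Qed.

(** Scalars are absorbed into the brackets, so every element of [derived] is a plain sum of
    brackets. *)
Lemma derived_ind (P : V -> Prop) :
  P 0 -> (forall u v, P u -> P v -> P (u + v)) -> (forall x y, P (br x y)) ->
  forall u, u \in derived -> P u.
Proof.
move=> P0 PD Pbr u /memv_sumP[w wim ->].
by apply: (big_ind P) => // i _; have /memv_imgP[y _ ->] := wim i isT; rewrite adE.
Qed.

Lemma derived_abelian u v : u \in derived -> v \in derived -> br u v = 0.
Proof.
move=> uD vD; elim/derived_ind: u / uD => [||x y].
- exact: linear0l.
- by move=> a b a0 b0; rewrite linearDl /= a0 b0 addr0.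
elim/derived_ind: v / vD => [||z w].
- exact: linear0r.
- by move=> a b a0 b0; rewrite linearDr /= a0 b0 addr0.
exact: (abelian_complex_metabelian br_lie J_abelian).
Qed.

Lemma derived_isotropic u v : u \in derived -> v \in derived -> omega u v = 0.
Proof.
move=> uD vD; rewrite omega_trace derived_abelian // linear0.
by rewrite trace_eq0 ?mulr0 // => x; rewrite adE linear0l.
Qed.

Lemma derived_J_eq0 z : z \in derived -> J z \in derived -> z = 0.
Proof.
move=> zD JzD; apply: (nondegenerate_eq omega_nd) => x.
rewrite linear0l omega_trace.
have adE2 : ad br (J (br z x)) =1 - (ad br x \o ad br (J z))%VF.
  move=> y; rewrite opp_lfunE comp_lfunE !adE brJ.
  rewrite (lie_leibniz br_lie) (derived_abelian zD (memv_derived x (J y))) addr0.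
  by rewrite brJ (linearNr br) opprK (lieC br_lie) opprK.
(* In the opposite order the composite is zero: [ad (J z)] kills [derived], which contains the range
   of [ad x]. *)
rewrite (eq_trace adE2) traceN trace_comp.
rewrite trace_eq0 ?oppr0 ?mulr0 // => y.
by rewrite comp_lfunE !adE derived_abelian // memv_derived.
Qed.

Lemma derived_perp_eq0 x : (forall u, u \in derived -> omega u x = 0) ->
  (forall u, u \in derived -> omega (J u) x = 0) -> x = 0.
Proof.
move=> Dx JDx.
have skew y z : omega (br x y) z = omega (br x z) y.
  have := omega_closed x y z; rewrite (Dx _ (memv_derived y z)).
  rewrite (lieC br_lie z x) (linearNl omega); lra.
have skewJ y z : omega (br (J x) y) z = omega (br (J x) z) y.
  have := omega_closed (J x) y z; have := JDx _ (memv_derived y z).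
  rewrite omega_J (lieC br_lie z (J x)) (linearNl omega); lra.
(* Moving [ad (J x)] and then [ad x] across [omega] carries [J] from inside the bracket to
   outside. *)
have adJ y : br (J x) y = J (br x y).
  apply: (nondegenerate_eq omega_nd) => z.
  by rewrite skewJ brJ (linearNl omega) /= skew omega_J.
have brx0 y : br x y = 0.
  by apply: derived_J_eq0; rewrite -?adJ memv_derived.
apply: (nondegenerate_eq omega_nd) => y.
rewrite linear0l omega_trace brx0 linear0.
by rewrite trace_eq0 ?mulr0 // => z; rewrite adE linear0l.
Qed.

Lemma derived_J_full : (derived + J @: derived)%VS = fullv.
Proof.
apply: (nondegenerate_fullv (omega := omega)) => x Dx; apply: derived_perp_eq0 => u uD.
  by apply: Dx; rewrite (subvP (addvSl _ _)).
by apply: Dx; rewrite (subvP (addvSr _ _)) // memv_img.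
Qed.

(* [aff_derived] below sends [(a, b)] to [b - J a], so that [J (a, b) = (- b, a)]
   and [derived] is the second factor. *)
Local Notation A := (subvs_of derived).

(** The bracket already lies in [derived]; [vsproj] only retypes it as an element of the
    subspace. *)
Definition derived_mul (a b : A) : A := vsproj derived (br (vsval a) (J (vsval b))).

Definition derived_form (a b : A) : R := omega (vsval a) (J (vsval b)).

Lemma derived_mulE a b : vsval (derived_mul a b) = br (vsval a) (J (vsval b)).
Proof. by rewrite vsprojK // memv_derived. Qed.

Lemma derived_mul_bilinear : bilinear_for *:%R *:%R derived_mul.
Proof.
split=> [b k u v|a k u v]; apply: subvs_inj; rewrite linearP /= !derived_mulE.
  by rewrite linearP (linearPl br).
by rewrite !linearP.
Qed.

HB.instance Definition _ :=
  bilinear_isBilinear.Build R A A A *:%R *:%R derived_mul derived_mul_bilinear.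

Lemma derived_form_bilinear :
  bilinear_for *%R (GRing.Scale.Law.clone _ _ (idfun \; *%R) _) derived_form.
Proof.
split=> [b k u v|a k u v]; rewrite /derived_form /=.
  by rewrite (linearPl omega).
by rewrite !linearP.
Qed.

HB.instance Definition _ :=
  bilinear_isBilinear.Build R A A R *%R (GRing.Scale.Law.clone _ _ (idfun \; *%R) _)
    derived_form derived_form_bilinear.

Lemma derived_form_symmetric a b :
  derived_form a b = (-1) ^+ false * idfun (derived_form b a).
Proof. by rewrite mul1r /= /derived_form skewC omega_J opprK. Qed.

HB.instance Definition _ :=
  isHermitianSesquilinear.Build R A false idfun derived_form derived_form_symmetric.

Lemma derived_mulC : commutative derived_mul.
Proof.
by move=> a b; apply: subvs_inj; rewrite !derived_mulE (lieC br_lie) brJ opprK.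
Qed.

Lemma derived_mulA : associative derived_mul.
Proof.
(* [J b] and [J d] commute because [b] and [d] do, so the Leibniz rule exchanges them. *)
have mulAC a b d : derived_mul (derived_mul a b) d = derived_mul (derived_mul a d) b.
  apply: subvs_inj; rewrite !derived_mulE (lie_leibniz br_lie) brJJ.
  by rewrite (derived_abelian (subvsP b)) ?subvsP // linear0r addr0.
by move=> a b d; rewrite derived_mulC mulAC (derived_mulC b).
Qed.

(** The range of [ad (J m)] lies in [derived], so its trace can be taken there, where it acts as
    minus multiplication by [m]. *)
Lemma derived_formE a b : derived_form a b = - c * trace_form derived_mul a b.
Proof.
rewrite /derived_form omega_trace -derived_mulE mulNr -mulrN /trace_form.
set m := derived_mul a b; congr (c * _).
have adJm : ad br (J (vsval m)) =1
    (linfun vsval \o (linfun (vsproj derived) \o ad br (J (vsval m))))%VF.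
  by move=> x; rewrite !comp_lfunE !lfunE /= vsprojK ?adE ?memv_derived.
rewrite (eq_trace adJm) trace_comp.
have mulm := linfun_linear (derived_mul_bilinear.2 m).
rewrite -(eq_trace mulm) -traceN; apply: eq_trace => d; rewrite opp_lfunE mulm.
apply: subvs_inj; rewrite !comp_lfunE !lfunE /= vsprojK ?memv_derived //.
by rewrite derived_mulE brJ.
Qed.

Lemma derived_form_invariant a b d :
  derived_form (derived_mul a b) d = derived_form a (derived_mul b d).
Proof. by rewrite !derived_formE /trace_form derived_mulA. Qed.

(** As [derived] is isotropic, an element in the kernel of the form is [omega]-orthogonal to both
    [derived] and its image under [J]. *)
Lemma derived_form_nondegenerate : nondegenerate (derived_form : {symmetric A}).
Proof.
apply/eqP/vspaceP => a; rewrite memv0; apply/idP/eqP => [|->]; last exact: mem0v.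
move/mem_orthovP => a_perp; apply: subvs_inj; apply: derived_perp_eq0 => u uD.
  by rewrite derived_isotropic ?subvsP.
have : derived_form a (vsproj derived u) = 0 := a_perp _ (memvf _).
by rewrite skewC /derived_form vsprojK // => ->; rewrite oppr0.
Qed.

Lemma derived_symmetric_algebra : symmetric_algebra derived_mul derived_form.
Proof.
split; [exact: derived_mulA | exact: derived_mulC | | ].
  exact: derived_form_nondegenerate.
exact: derived_form_invariant.
Qed.

Definition aff_derived (p : (A * A)%type) : V := vsval p.2 - J (vsval p.1).

Lemma aff_derived_linear : linear aff_derived.
Proof.
by move=> k p q; rewrite /aff_derived /= !linearP /= scalerDr addrACA.
Qed.

Lemma aff_derived_lker0 : lker (linfun aff_derived) == 0%VS.
Proof.
apply/eqP/vspaceP => p; rewrite memv_ker memv0.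
apply/eqP/eqP => [|->]; last exact: linear0.
rewrite (linfun_linear aff_derived_linear) => /eqP.
rewrite subr_eq0 => /eqP p2E; case: p p2E => a b /= bE.
have a0 : vsval a = 0 by apply: derived_J_eq0; rewrite -?bE subvsP.
by rewrite a0 linear0 in bE; congr pair; apply: subvs_inj; rewrite ?a0 ?bE.
Qed.

Lemma aff_derived_limg : limg (linfun aff_derived) = fullv.
Proof.
apply/eqP; rewrite eqEsubv subvf -derived_J_full /=; apply/subvP => x.
case/memv_addP => b bD [_ /memv_imgP[a aD ->] ->].
have -> : b + J a = linfun aff_derived (- vsproj derived a, vsproj derived b).
  by rewrite (linfun_linear aff_derived_linear) /aff_derived /= !linearN /= opprK !vsprojK.
exact: memv_img (memvf _).
Qed.

Lemma aff_derived_br p q :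
  br (aff_derived p) (aff_derived q) = aff_derived (aff_bracket derived_mul p q).
Proof.
rewrite /aff_derived /= !linear0 addr0 !derived_mulE.
rewrite linearBl /= !linearBr /= brJJ !(derived_abelian (subvsP _) (subvsP _)).
rewrite (lieC br_lie (vsval q.1)) !brJ.
by rewrite subr0 sub0r !opprK addrC.
Qed.

Lemma aff_derived_J p : J (aff_derived p) = aff_derived (aff_complex p).
Proof. by rewrite /aff_derived /= linearB !linearN /= JJ !opprK addrC. Qed.

Lemma aff_derived_omega p q :
  omega (aff_derived p) (aff_derived q) = aff_symplectic derived_form p q.
Proof.
rewrite /aff_derived /aff_symplectic /derived_form linearBl /= !linearBr /=.
rewrite (pseudo_kahler_compatible pK) !(derived_isotropic (subvsP _) (subvsP _)) omega_J.
by rewrite subr0 sub0r opprK addrC.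
Qed.

Lemma aff_derived_symplectomorphic :
  holomorphically_symplectomorphic br omega J
    (aff_bracket derived_mul) (aff_symplectic derived_form) (@aff_complex R A).
Proof.
have phiE : linfun aff_derived =1 aff_derived.
  exact: linfun_linear aff_derived_linear.
have phiK := lker0_lfunK aff_derived_lker0.
have Kphi : cancel (linfun aff_derived)^-1%VF (linfun aff_derived).
  by move=> x; rewrite limg_lfunVK // aff_derived_limg memvf.
(* [aff_derived] maps into [V], so its inverse is the required isomorphism. *)
exists (linfun aff_derived)^-1%VF; split.
- by exists (linfun aff_derived).
- move=> x y; rewrite -{1}[x]Kphi -{1}[y]Kphi !(phiE (_^-1%VF _)).
  by rewrite aff_derived_br -phiE phiK.
- by move=> x; rewrite -{1}[x]Kphi phiE aff_derived_J -phiE phiK.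
- move=> x y; rewrite -{2}[x]Kphi -{2}[y]Kphi !(phiE (_^-1%VF _)).
  by rewrite aff_derived_omega.
Qed.

Lemma trace_symplectic_aff :
  exists (A : vectType R) (mul : {bilinear A -> A -> A}) (B : {symmetric A}),
    [/\ symmetric_algebra mul B,
        semisimple mul,
        exists gamma : R, forall a b, B a b = gamma * trace_form mul a b &
        holomorphically_symplectomorphic br omega J
          (aff_bracket mul) (aff_symplectic B) (@aff_complex R A)].
Proof.
exists A, derived_mul, derived_form; split.
- exact: derived_symmetric_algebra.
- exact: trace_form_semisimple derived_symmetric_algebra derived_formE.
- by exists (- c); apply: derived_formE.
- exact: aff_derived_symplectomorphic.
Qed.

End TraceSymplectic.

Theorem proposition4p8 (R : realType) (V : vectType R)
    (br : {bilinear V -> V -> V}) (omega : {skew_symmetric V}) (J : 'End(V))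
    (br_lie : lie_bracket br)
    (pK : abelian_pseudo_kahler br omega J)
    (g_einstein : einstein br (kahler_metric omega J))
    (g_not_flat : ~ ricci_flat br (kahler_metric omega J)) :
  exists (A : vectType R) (mul : {bilinear A -> A -> A}) (B : {symmetric A}),
    [/\ symmetric_algebra mul B,
        semisimple mul,
        exists gamma : R, forall a b, B a b = gamma * trace_form mul a b &
        holomorphically_symplectomorphic br omega J
          (aff_bracket mul) (aff_symplectic B) (@aff_complex R A)].
Proof.
have [gamma einst] := g_einstein.
exact: (trace_symplectic_aff br_lie pK (einstein_omega br_lie pK einst)).
Qed.
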